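(* The array property fragment of the theory $\mathcal{T}$ of arrays and integers is not closed under interpolation. That is, there exist formulas $A$ and $B$, both in the array property fragment, such that $A \land B$ is $\mathcal{T}$-unsatisfiable, but there is no formula $I$ in the array property fragment such that (i) $A \models_{\mathcal{T}} I$, (ii) $I \land B$ is $\mathcal{T}$-unsatisfiable, and (iii) every non-theory symbol occurring in $I$ occurs in both $A$ and $B$.
   Context: The theory $\mathcal{T}$ is the combination of the theory of integers and the theory of arrays. Its signature has the sort $\mathrm{Int}$, interpreted as $\mathbb{Z}$, with integer constants and the usual functions $+,-,*$ and predicates $<,\leq$ interpreted as usual. It also has array sorts $\mathrm{Array}\ \sigma_I\,\sigma_E$, interpreted as the set of all functions $\sigma_I \to \sigma_E$. For these there are a select function $a[i]$, interpreted as $a(i)$, and a store function $a\langle i \triangleleft v\rangle$, interpreted as the function that maps $i$ to $v$ and agrees with $a$ everywhere else. Formulas may additionally contain uninterpreted (free) constant symbols of these sorts. A model of $\mathcal{T}$ is any interpretation of the free symbols together with this fixed interpretation of the theory symbols. A formula is $\mathcal{T}$-unsatisfiable if it holds in no model of $\mathcal{T}$, and $A \models_{\mathcal{T}} I$ means that every model of $\mathcal{T}$ satisfying $A$ satisfies $I$. An array property is a formula $\forall \bar{j}.\, \varphi_I(\bar{j}) \rightarrow \varphi_V(\bar{j})$, where $\bar{j}$ are universally quantified integer index variables, subject to the following restrictions. - The index guard $\varphi_I(\bar{j})$ is built with $\land$ and $\lor$ from ground literals and from literals of the forms $j \leq t$, $t \leq j$, $j \leq j'$, $j = t$, $j = j'$.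 Here $t$ is a ground term (one containing no quantified variables) and $j, j' \in \bar{j}$. Literals containing quantified variables must not appear negated. - The value constraint $\varphi_V(\bar{j})$ consists of ground literals and of literals in which quantified variables $j$ occur only as the index of array reads $a[j]$. Such reads on quantified variables must not be nested, i.e. $a[j]$ must not occur inside an argument of a select or store term. The array property fragment consists of all Boolean combinations of array properties and quantifier-free formulas; in particular there is no quantifier alternation. An interpolation problem is a pair $(A,B)$ of formulas with $A \land B$ $\mathcal{T}$-unsatisfiable. A Craig interpolant for it is a formula $I$ satisfying (i)–(iii) above. A fragment is closed under interpolation if every interpolation problem with $A$ and $B$ in the fragment has an interpolant in the fragment. *)

(* Defs.v *)
From Stdlib Require Import ZArith List ClassicalEpsilon.
Import ListNotations.

Set Implicit Arguments.

Inductive sort : Set :=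
| Int
| Array (sI sE : sort).

Fixpoint dom (s : sort) : Set :=
  match s with
  | Int => Z
  | Array sI sE => dom sI -> dom sE
  end.

(** [Cst s c] is the [c]-th free constant symbol of sort [s]; [Var x] is an
    integer variable, meant to be bound by [FAll x].  The two name spaces are
    disjoint. *)
Inductive term : sort -> Set :=
| Cst (s : sort) (c : nat) : term s
| Var (x : nat) : term Int
| Num (z : Z) : term Int
| Add (t u : term Int) : term Int
| Sub (t u : term Int) : term Int
| Mul (t u : term Int) : term Int
| Select (sI sE : sort) (a : term (Array sI sE)) (i : term sI) : term sE
| Store (sI sE : sort) (a : term (Array sI sE)) (i : term sI) (v : term sE) :
    term (Array sI sE).

Inductive formula : Set :=
| FEq (s : sort) (t u : term s)
| FLt (t u : term Int)
| FLe (t u : term Int)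
| FNot (p : formula)
| FAnd (p q : formula)
| FOr (p q : formula)
| FImp (p q : formula)
| FAll (x : nat) (p : formula).

(** The theory symbols have a fixed meaning, so a model is an interpretation of
    the free constants. *)
Definition model : Type := forall s : sort, nat -> dom s.

Definition env : Set := nat -> Z.

Definition upd (r : env) (x : nat) (z : Z) : env :=
  fun y => if Nat.eqb y x then z else r y.

Definition store (I E : Set) (a : I -> E) (i : I) (v : E) : I -> E :=
  fun k => if excluded_middle_informative (k = i) then v else a k.

Fixpoint eval (M : model) (r : env) (s : sort) (t : term s) : dom s :=
  match t in term s return dom s with
  | Cst s c => M s c
  | Var x => r x
  | Num z => z
  | Add t u => (eval M r t + eval M r u)%Z
  | Sub t u => (eval M r t - eval M r u)%Z
  | Mul t u => (eval M r t * eval M r u)%Z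
  | Select a i => (eval M r a) (eval M r i)
  | Store a i v => store (eval M r a) (eval M r i) (eval M r v)
  end.

Fixpoint holds (M : model) (r : env) (p : formula) : Prop :=
  match p with
  | FEq t u => eval M r t = eval M r u
  | FLt t u => (eval M r t < eval M r u)%Z
  | FLe t u => (eval M r t <= eval M r u)%Z
  | FNot p => ~ holds M r p
  | FAnd p q => holds M r p /\ holds M r q
  | FOr p q => holds M r p \/ holds M r q
  | FImp p q => holds M r p -> holds M r q
  | FAll x p => forall z : Z, holds M (upd r x z) p
  end.

(** The formulas of the array property fragment below are closed, so that the
    environment plays no role for them. *)
Definition unsat (p : formula) : Prop :=
  forall (M : model) (r : env), ~ holds M r p.

Definition entails (p q : formula) : Prop :=
  forall (M : model) (r : env), holds M r p -> holds M r q.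

Fixpoint tsyms (s : sort) (t : term s) : list (sort * nat) :=
  match t with
  | Cst s c => [(s, c)]
  | Var _ | Num _ => []
  | Add t u | Sub t u | Mul t u => tsyms t ++ tsyms u
  | Select a i => tsyms a ++ tsyms i
  | Store a i v => tsyms a ++ tsyms i ++ tsyms v
  end.

Fixpoint fsyms (p : formula) : list (sort * nat) :=
  match p with
  | FEq t u => tsyms t ++ tsyms u
  | FLt t u | FLe t u => tsyms t ++ tsyms u
  | FNot p | FAll _ p => fsyms p
  | FAnd p q | FOr p q | FImp p q => fsyms p ++ fsyms q
  end.

Fixpoint ground (s : sort) (t : term s) : Prop :=
  match t with
  | Var _ => False
  | Cst _ _ | Num _ => True
  | Add t u | Sub t u | Mul t u => ground t /\ ground u
  | Select a i => ground a /\ ground i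
  | Store a i v => ground a /\ ground i /\ ground v
  end.

Inductive ground_atom : formula -> Prop :=
| ground_eq s (t u : term s) : ground t -> ground u -> ground_atom (FEq t u)
| ground_lt t u : ground t -> ground u -> ground_atom (FLt t u)
| ground_le t u : ground t -> ground u -> ground_atom (FLe t u).

Inductive ground_literal : formula -> Prop :=
| ground_pos p : ground_atom p -> ground_literal p
| ground_neg p : ground_atom p -> ground_literal (FNot p).

Inductive index_guard (js : list nat) : formula -> Prop :=
| guard_ground p : ground_literal p -> index_guard js p
| guard_var_le_term j t :
    In j js -> ground t -> index_guard js (FLe (Var j) t)
| guard_term_le_var j t :
    In j js -> ground t -> index_guard js (FLe t (Var j))
| guard_var_le_var j j' :
    In j js -> In j' js -> index_guard js (FLe (Var j) (Var j'))
| guard_var_eq_term j t :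
    In j js -> ground t -> index_guard js (FEq (Var j) t)
| guard_var_eq_var j j' :
    In j js -> In j' js -> index_guard js (FEq (Var j) (Var j'))
| guard_and p q :
    index_guard js p -> index_guard js q -> index_guard js (FAnd p q)
| guard_or p q :
    index_guard js p -> index_guard js q -> index_guard js (FOr p q).

Definition is_var_in (js : list nat) (s : sort) (t : term s) : Prop :=
  match t with
  | Var j => In j js
  | _ => False
  end.

(** Terms in which the quantified variables occur only in reads [a[j]] that are
    not themselves inside an argument of a select or store: below a select or
    store everything is ground, apart from the variable [j] of such a read. *)
Fixpoint value_term (js : list nat) (s : sort) (t : term s) : Prop :=
  match t with
  | Var _ => False
  | Cst _ _ | Num _ => True
  | Add t u | Sub t u | Mul t u => value_term js t /\ value_term js u
  | Select a i => ground a /\ (ground i \/ is_var_in js i)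
  | Store a i v => ground a /\ ground i /\ ground v
  end.

(** Any propositional combination of the admissible literals is allowed; ground
    literals are included because ground terms are value terms. *)
Fixpoint value_constraint (js : list nat) (p : formula) : Prop :=
  match p with
  | FEq t u => value_term js t /\ value_term js u
  | FLt t u | FLe t u => value_term js t /\ value_term js u
  | FNot p => value_constraint js p
  | FAnd p q | FOr p q | FImp p q =>
      value_constraint js p /\ value_constraint js q
  | FAll _ _ => False
  end.

Definition forall_vars (js : list nat) (p : formula) : formula :=
  fold_right FAll p js.

Inductive array_property : formula -> Prop :=
| array_property_intro js pI pV :
    index_guard js pI -> value_constraint js pV ->
    array_property (forall_vars js (FImp pI pV)).

(** All quantifier-free sentences are included: [apf_ground] gives their atoms
    and the closure rules the connectives. *)
Inductive array_property_fragment : formula -> Prop :=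
| apf_array_property p : array_property p -> array_property_fragment p
| apf_ground p : ground_atom p -> array_property_fragment p
| apf_not p : array_property_fragment p -> array_property_fragment (FNot p)
| apf_and p q :
    array_property_fragment p -> array_property_fragment q ->
    array_property_fragment (FAnd p q)
| apf_or p q :
    array_property_fragment p -> array_property_fragment q ->
    array_property_fragment (FOr p q)
| apf_imp p q :
    array_property_fragment p -> array_property_fragment q ->
    array_property_fragment (FImp p q).

Definition interpolation_problem (A B : formula) : Prop := unsat (FAnd A B).

Definition interpolant (A B I : formula) : Prop :=
  entails A I /\
  unsat (FAnd I B) /\
  (forall (s : sort) (c : nat),
     In (s, c) (fsyms I) -> In (s, c) (fsyms A) /\ In (s, c) (fsyms B)).

(* Main.v *)
Require Import Defs.
From Stdlib Require Import ZArith List Lia ClassicalEpsilon FunctionalExtensionality.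
Import ListNotations.

(** Let [A] say that the array [a] vanishes outside the local index [i], and [B]
    that [a] is nonzero at the two local indices [i1 < i2].  The only shared
    symbol is [a].  Fix a formula [I] of the fragment over [a] alone.  Let [a] be
    the indicator of [{N}] or of [{N, N+1}].  For [N] large, the finitely many
    ground integer terms of [I] take the same values, all below [N], in both
    cases.  Array properties compare quantified indices only by [<=] and [=], so
    they are preserved by monotone index maps that fix everything below [N] and
    respect the array.  Such maps exist both ways: skip [N+1], or collapse it
    onto [N].  Hence [I] cannot separate the two models, although the first
    satisfies [A] and the second [B]. *)

Local Open Scope Z_scope.

Notation array_sym := (Array Int Int, 0%nat).
Notation array_cst := (Cst (Array Int Int) 0).

(** * Properties of all sufficiently large integers *)

Definition eventually (P : Z -> Prop) : Prop :=
  exists N0, forall N, N0 <= N -> P N.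

Lemma eventually_always (P : Z -> Prop) : (forall N, P N) -> eventually P.
Proof. intros H; exists 0; auto. Qed.

Lemma eventually_gt (k : Z) : eventually (fun N => k < N).
Proof. exists (k + 1); lia. Qed.

Lemma eventually_imp (P Q : Z -> Prop) :
  (forall N, P N -> Q N) -> eventually P -> eventually Q.
Proof. intros H [N0 HP]; exists N0; auto. Qed.

Lemma eventually_and (P Q : Z -> Prop) :
  eventually P -> eventually Q -> eventually (fun N => P N /\ Q N).
Proof.
  intros [N1 HP] [N2 HQ]; exists (Z.max N1 N2).
  intros N HN; split; [apply HP | apply HQ]; lia.
Qed.

(** * Values of ground terms over the shared array *)

Fixpoint zero (s : sort) : dom s :=
  match s with
  | Int => 0
  | Array sI sE => fun _ => zero sE
  end.

Definition zero_model : model := fun s _ => zero s.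

Definition shared_array (M : model) : Z -> Z := M (Array Int Int) 0%nat.

Definition vanishes_below (N : Z) (M : model) : Prop :=
  forall z, z < N -> shared_array M z = 0.

(** Only the sorts [Int] and [Array Int Int] have ground terms over the shared
    array, hence [False] at every other sort. *)
Definition ground_value_at (N : Z) (M : model) (s : sort) :
    dom s -> dom s -> Prop :=
  match s return dom s -> dom s -> Prop with
  | Int => fun x0 x => x = x0 /\ x0 < N
  | Array Int Int => fun x0 x =>
      (forall z, z < N -> x z = x0 z) /\
      (forall z, N <= z -> x z = shared_array M z)
  | _ => fun _ _ => False
  end.

(** The reference value is taken in [zero_model], so it depends neither on [N] nor on [M], and [N]
    can be chosen above the values of the finitely many integer subterms. Every read or write then
    happens below [N], where arrays agree with their reference. *)
Lemma eval_ground (r0 : env) (s : sort) (t : term s) :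
  ground t -> incl (tsyms t) [array_sym] ->
  eventually (fun N => forall M r, vanishes_below N M ->
    ground_value_at N M s (eval zero_model r0 t) (eval M r t)).
Proof.
  induction t as [s c | x | z | t IHt u IHu | t IHt u IHu | t IHt u IHu
    | sI sE a IHa i IHi | sI sE a IHa i IHi v IHv]; simpl; intros G S.
  - assert (E : array_sym = (s, c)).
    { destruct (S (s, c)) as [E | []]; [now left | exact E]. }
    injection E as <- <-.
    apply eventually_always; intros N M r HM; split; [exact HM | reflexivity].
  - destruct G.
  - apply (eventually_imp _ _) with (2 := eventually_gt z); auto.
  - apply incl_app_inv in S as [S1 S2]; destruct G as [G1 G2].
    (* [N] must exceed the value of the sum itself, not only those of the summands. *)
    refine (eventually_imp _ _ _ (eventually_and _ _ (eventually_gt _)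
      (eventually_and _ _ (IHt G1 S1) (IHu G2 S2)))).
    intros N (HN & Ht & Hu) M r HM.
    destruct (Ht M r HM) as [-> _], (Hu M r HM) as [-> _].
    split; [reflexivity | exact HN].
  - apply incl_app_inv in S as [S1 S2]; destruct G as [G1 G2].
    refine (eventually_imp _ _ _ (eventually_and _ _ (eventually_gt _)
      (eventually_and _ _ (IHt G1 S1) (IHu G2 S2)))).
    intros N (HN & Ht & Hu) M r HM.
    destruct (Ht M r HM) as [-> _], (Hu M r HM) as [-> _].
    split; [reflexivity | exact HN].
  - apply incl_app_inv in S as [S1 S2]; destruct G as [G1 G2].
    refine (eventually_imp _ _ _ (eventually_and _ _ (eventually_gt _)
      (eventually_and _ _ (IHt G1 S1) (IHu G2 S2)))).
    intros N (HN & Ht & Hu) M r HM.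
    destruct (Ht M r HM) as [-> _], (Hu M r HM) as [-> _].
    split; [reflexivity | exact HN].
  - apply incl_app_inv in S as [S1 S2]; destruct G as [G1 G2].
    specialize (IHa G1 S1); specialize (IHi G2 S2).
    destruct sI as [| sI1 sI2];
      [destruct sE as [| sE1 sE2] |];
      try solve [refine (eventually_imp _ _ _ IHa); intros N Ha M r HM;
                 destruct (Ha M r HM)].
    refine (eventually_imp _ _ _ (eventually_and _ _ (eventually_gt _)
      (eventually_and _ _ IHa IHi))).
    intros N (HN & Ha & Hi) M r HM.
    destruct (Ha M r HM) as [Hlow _], (Hi M r HM) as [-> Hi0].
    split; [apply Hlow, Hi0 | exact HN].
  - apply incl_app_inv in S as [S1 S2]; apply incl_app_inv in S2 as [S2 S3].
    destruct G as (G1 & G2 & G3).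
    specialize (IHa G1 S1); specialize (IHi G2 S2); specialize (IHv G3 S3).
    destruct sI as [| sI1 sI2];
      [destruct sE as [| sE1 sE2] |];
      try solve [refine (eventually_imp _ _ _ IHa); intros N Ha M r HM;
                 destruct (Ha M r HM)].
    refine (eventually_imp _ _ _ (eventually_and _ _ IHa
      (eventually_and _ _ IHi IHv))).
    intros N (Ha & Hi & Hv) M r HM.
    destruct (Ha M r HM) as [Hlow Hhigh], (Hi M r HM) as [-> Hi0],
      (Hv M r HM) as [-> _].
    unfold store; split; intros z Hz;
      destruct excluded_middle_informative as [-> | _]; auto.
    (* A write at an index at or above [N] is impossible, since the index value is below [N]. *)
    exfalso; simpl in *; lia.
Qed.

(** * Simulations and value constraints *)

(** The map [h] runs backwards, from indices of [M'] to indices of [M], so that universal statements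
    pass from [M] to [M']. It need not be injective or surjective. *)
Record simulation (N : Z) (h : Z -> Z) (M M' : model) : Prop := {
  sim_source : vanishes_below N M;
  sim_target : vanishes_below N M';
  sim_mono : forall z z', z <= z' -> h z <= h z';
  sim_low : forall z, z < N -> h z = z;
  sim_high : forall z, N <= z -> N <= h z;
  sim_array : forall z, N <= z -> shared_array M' z = shared_array M (h z)
}.

Definition value_rel (N : Z) (M M' : model) (s : sort) : dom s -> dom s -> Prop :=
  match s return dom s -> dom s -> Prop with
  | Int => fun x x' => x = x'
  | Array Int Int => fun x x' =>
      (forall z, z < N -> x z = x' z) /\
      (forall z, N <= z -> x z = shared_array M z /\ x' z = shared_array M' z)
  | _ => fun _ _ => False
  end.

(** Both values are compared with the same reference value in [zero_model]. *)
Lemma eval_ground_rel (s : sort) (t : term s) :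
  ground t -> incl (tsyms t) [array_sym] ->
  eventually (fun N => forall M M' h r r', simulation N h M M' ->
    value_rel N M M' s (eval M r t) (eval M' r' t)).
Proof.
  intros G S.
  refine (eventually_imp _ _ _ (eval_ground (fun _ => 0) s t G S)).
  intros N H M M' h r r' Hs.
  pose proof (H M r (sim_source _ _ _ _ Hs)) as H1.
  pose proof (H M' r' (sim_target _ _ _ _ Hs)) as H2.
  revert H1 H2; generalize (eval zero_model (fun _ => 0) t) (eval M r t)
    (eval M' r' t); clear.
  destruct s as [| [|] [|]]; simpl; try tauto.
  - intuition congruence.
  - intros x0 x x' [L1 H1] [L2 H2]; split; intros z Hz; [| auto].
    rewrite L1, L2; auto.
Qed.

(** The only select or store term that is not ground is a read at a quantified variable, and its
    array is ground. *)
Lemma eval_value_rel (js : list nat) (s : sort) (t : term s) :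
  value_term js t -> incl (tsyms t) [array_sym] ->
  eventually (fun N => forall M M' h r r', simulation N h M M' ->
    (forall x, r x = h (r' x)) ->
    value_rel N M M' s (eval M r t) (eval M' r' t)).
Proof.
  induction t as [s c | x | z | t IHt u IHu | t IHt u IHu | t IHt u IHu
    | sI sE a IHa i IHi | sI sE a IHa i IHi v IHv]; intros V S.
  - refine (eventually_imp _ _ _ (eval_ground_rel _ (Cst s c) I S)); eauto.
  - destruct V.
  - now apply eventually_always.
  - apply incl_app_inv in S as [S1 S2]; destruct V as [V1 V2].
    refine (eventually_imp _ _ _ (eventually_and _ _ (IHt V1 S1) (IHu V2 S2))).
    intros N [Ht Hu] M M' h r r' Hs Hr; simpl.
    rewrite (Ht M M' h r r' Hs Hr), (Hu M M' h r r' Hs Hr); reflexivity.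
  - apply incl_app_inv in S as [S1 S2]; destruct V as [V1 V2].
    refine (eventually_imp _ _ _ (eventually_and _ _ (IHt V1 S1) (IHu V2 S2))).
    intros N [Ht Hu] M M' h r r' Hs Hr; simpl.
    rewrite (Ht M M' h r r' Hs Hr), (Hu M M' h r r' Hs Hr); reflexivity.
  - apply incl_app_inv in S as [S1 S2]; destruct V as [V1 V2].
    refine (eventually_imp _ _ _ (eventually_and _ _ (IHt V1 S1) (IHu V2 S2))).
    intros N [Ht Hu] M M' h r r' Hs Hr; simpl.
    rewrite (Ht M M' h r r' Hs Hr), (Hu M M' h r r' Hs Hr); reflexivity.
  - clear IHa IHi; destruct V as [Ga [Gi | Vi]].
    + refine (eventually_imp _ _ _
        (eval_ground_rel _ (Select a i) (conj Ga Gi) S)); eauto.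
    + apply incl_app_inv in S as [Sa _].
      refine (eventually_imp _ _ _ (eval_ground_rel _ a Ga Sa)).
      intros N Ha M M' h r r' Hs Hr; specialize (Ha M M' h r r' Hs).
      destruct i as [| j | | | | | |]; try destruct Vi.
      destruct sE as [|]; [| destruct Ha].
      destruct Ha as [Hlow Hhigh]; simpl; rewrite Hr.
      (* Below [N] the map [h] is the identity; from [N] on both arrays are the shared ones, which
         [h] respects. *)
      destruct (Z.lt_ge_cases (r' j) N) as [Hj | Hj].
      * rewrite (sim_low _ _ _ _ Hs) by exact Hj; auto.
      * destruct (Hhigh _ (sim_high _ _ _ _ Hs _ Hj)) as [-> _],
          (Hhigh _ Hj) as [_ ->].
        symmetry; apply (sim_array _ _ _ _ Hs _ Hj).
  - refine (eventually_imp _ _ _ (eval_ground_rel _ (Store a i v) V S)); eauto.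
Qed.

(** From [N] on, all array values of one model coincide with its shared array, so equality is
    decided below [N], where the two models agree. *)
Lemma value_rel_eq (N : Z) (M M' : model) (s : sort) (x y x' y' : dom s) :
  value_rel N M M' s x x' -> value_rel N M M' s y y' -> (x = y <-> x' = y').
Proof.
  destruct s as [| [|] [|]]; simpl; try tauto.
  - intros -> ->; reflexivity.
  - intros [Lx Hx] [Ly Hy]; split; intros E; apply functional_extensionality;
      intros z; (destruct (Z.lt_ge_cases z N) as [Hz | Hz];
        [specialize (Lx z Hz); specialize (Ly z Hz)
        | destruct (Hx z Hz), (Hy z Hz)]); congruence.
Qed.

Lemma value_constraint_iff (js : list nat) (p : formula) :
  value_constraint js p -> incl (fsyms p) [array_sym] ->
  eventually (fun N => forall M M' h r r', simulation N h M M' ->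
    (forall x, r x = h (r' x)) -> (holds M r p <-> holds M' r' p)).
Proof.
  induction p as [s t u | t u | t u | p IHp | p IHp q IHq | p IHp q IHq
    | p IHp q IHq | x p IHp]; simpl; intros V S.
  all: try (apply incl_app_inv in S as [S1 S2]; destruct V as [V1 V2]).
  all: try (refine (eventually_imp _ _ _ (eventually_and _ _
    (eval_value_rel js _ _ V1 S1) (eval_value_rel js _ _ V2 S2)));
    intros N [Ht Hu] M M' h r r' Hs Hr;
    specialize (Ht M M' h r r' Hs Hr); specialize (Hu M M' h r r' Hs Hr)).
  all: try (refine (eventually_imp _ _ _
    (eventually_and _ _ (IHp V1 S1) (IHq V2 S2)));
    intros N [Hp Hq] M M' h r r' Hs Hr;
    specialize (Hp M M' h r r' Hs Hr); specialize (Hq M M' h r r' Hs Hr);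
    tauto).
  - exact (value_rel_eq _ _ _ _ _ _ _ _ Ht Hu).
  - simpl in Ht, Hu; rewrite Ht, Hu; reflexivity.
  - simpl in Ht, Hu; rewrite Ht, Hu; reflexivity.
  - refine (eventually_imp _ _ _ (IHp V S)); intros N Hp M M' h r r' Hs Hr.
    specialize (Hp M M' h r r' Hs Hr); tauto.
  - destruct V.
Qed.

Lemma ground_value_term (js : list nat) (s : sort) (t : term s) :
  ground t -> value_term js t.
Proof. induction t; simpl; tauto. Qed.

Lemma ground_atom_value_constraint (js : list nat) (p : formula) :
  ground_atom p -> value_constraint js p.
Proof. destruct 1; simpl; auto using ground_value_term. Qed.

(** * Index guards and array properties *)

(** One direction only: a monotone [h] preserves [<=] and [=] between variables but may fail to
    reflect them, as when two indices are collapsed. *)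
Lemma index_guard_transfer (js : list nat) (p : formula) :
  index_guard js p -> incl (fsyms p) [array_sym] ->
  eventually (fun N => forall M M' h r r', simulation N h M M' ->
    (forall x, r x = h (r' x)) -> holds M' r' p -> holds M r p).
Proof.
  assert (bounded : forall t : term Int, ground t ->
    incl (tsyms t) [array_sym] ->
    eventually (fun N => forall M M' h r r', simulation N h M M' ->
      eval M r t = eval M' r' t /\ eval M r t < N)).
  { intros t G S.
    refine (eventually_imp _ _ _ (eval_ground (fun _ => 0) _ t G S)).
    intros N H M M' h r r' Hs.
    destruct (H M r (sim_source _ _ _ _ Hs)), (H M' r' (sim_target _ _ _ _ Hs)).
    split; congruence. }
  induction 1 as [p Hp | j t Hj G | j t Hj G | j j' Hj Hj' | j t Hj G
    | j j' Hj Hj' | p q Hp IHp Hq IHq | p q Hp IHp Hq IHq]; intros S.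
  - assert (V : value_constraint js p).
    { destruct Hp; simpl; now apply ground_atom_value_constraint. }
    refine (eventually_imp _ _ _ (value_constraint_iff js p V S)).
    intros N H M M' h r r' Hs Hr; apply (H M M' h r r' Hs Hr).
  - refine (eventually_imp _ _ _ (bounded t G S)).
    intros N H M M' h r r' Hs Hr; destruct (H M M' h r r' Hs) as [E L].
    simpl; rewrite Hr, <- E; intros Hle.
    (* The index is at most the value of [t], hence below [N] and fixed by [h]. *)
    rewrite (sim_low _ _ _ _ Hs); lia.
  - assert (S' : incl (tsyms t) [array_sym]) by now apply incl_app_inv in S.
    refine (eventually_imp _ _ _ (bounded t G S')).
    intros N H M M' h r r' Hs Hr; destruct (H M M' h r r' Hs) as [E L].
    simpl; rewrite Hr, <- E; intros Hle.
    destruct (Z.lt_ge_cases (r' j) N) as [Hz | Hz].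
    + rewrite (sim_low _ _ _ _ Hs); lia.
    (* The image stays at or above [N], hence above the value of [t]. *)
    + pose proof (sim_high _ _ _ _ Hs _ Hz); lia.
  - apply eventually_always; intros N M M' h r r' Hs Hr; simpl.
    rewrite !Hr; apply (sim_mono _ _ _ _ Hs).
  - refine (eventually_imp _ _ _ (bounded t G S)).
    intros N H M M' h r r' Hs Hr; destruct (H M M' h r r' Hs) as [E L].
    simpl; rewrite Hr, <- E; intros Heq.
    rewrite (sim_low _ _ _ _ Hs); lia.
  - apply eventually_always; intros N M M' h r r' Hs Hr; simpl.
    rewrite !Hr; congruence.
  - apply incl_app_inv in S as [S1 S2].
    refine (eventually_imp _ _ _ (eventually_and _ _ (IHp S1) (IHq S2))).
    intros N [H1 H2] M M' h r r' Hs Hr [K1 K2]; simpl; eauto.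
  - apply incl_app_inv in S as [S1 S2].
    refine (eventually_imp _ _ _ (eventually_and _ _ (IHp S1) (IHq S2))).
    intros N [H1 H2] M M' h r r' Hs Hr [K | K]; simpl; eauto.
Qed.

Lemma fsyms_forall_vars (js : list nat) (p : formula) :
  fsyms (forall_vars js p) = fsyms p.
Proof. induction js; simpl; auto. Qed.

Lemma forall_vars_transfer (h : Z -> Z) (M M' : model) (js : list nat)
    (p : formula) :
  (forall r r', (forall x, r x = h (r' x)) -> holds M r p -> holds M' r' p) ->
  forall r r', (forall x, r x = h (r' x)) ->
    holds M r (forall_vars js p) -> holds M' r' (forall_vars js p).
Proof.
  intros Hp; induction js as [| j js IH]; simpl; [exact Hp |].
  (* An index [z] of [M'] is answered by its image [h z] in [M]. *)
  intros r r' Hr H z; refine (IH _ _ _ (H (h z))).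
  intros x; unfold upd; destruct Nat.eqb; auto.
Qed.

(** The guard is pulled back from [M'] to [M], the property is applied there, and the value
    constraint is carried forward to [M']. *)
Lemma array_property_transfer (p : formula) :
  array_property p -> incl (fsyms p) [array_sym] ->
  eventually (fun N => forall M M' h r r', simulation N h M M' ->
    (forall x, r x = h (r' x)) -> holds M r p -> holds M' r' p).
Proof.
  intros [js pI pV HI HV]; rewrite fsyms_forall_vars; intros S.
  apply incl_app_inv in S as [S1 S2].
  refine (eventually_imp _ _ _ (eventually_and _ _
    (index_guard_transfer js pI HI S1) (value_constraint_iff js pV HV S2))).
  intros N [H1 H2] M M' h r r' Hs; apply forall_vars_transfer; clear r r'.
  intros r r' Hr H K; apply (H2 M M' h r r' Hs Hr), H.
  exact (H1 M M' h r r' Hs Hr K).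
Qed.

(** One simulation carries array properties one way only; closure under negation requires an
    equivalence, hence simulations in both directions. *)
Lemma array_property_fragment_iff (p : formula) :
  array_property_fragment p -> incl (fsyms p) [array_sym] ->
  eventually (fun N => forall M M' h g,
    simulation N h M M' -> simulation N g M' M ->
    (holds M (fun _ => 0) p <-> holds M' (fun _ => 0) p)).
Proof.
  induction 1 as [p Hp | p Hp | p Hp IHp | p q Hp IHp Hq IHq
    | p q Hp IHp Hq IHq | p q Hp IHp Hq IHq]; simpl; intros S.
  1: refine (eventually_imp _ _ _ (eventually_and _ _ (eventually_gt 0)
       (array_property_transfer p Hp S)));
     intros N [HN H] M M' h g Hh Hg; split;
     [apply (H M M' h) | apply (H M' M g)]; auto;
     (* The constant environment 0 is related to itself, because [0 < N] makes 0 a fixed point of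
        the index map. *)
     intros _; symmetry; eapply sim_low; eauto.
  1: refine (eventually_imp _ _ _ (eventually_and _ _ (eventually_gt 0)
       (value_constraint_iff [] p (ground_atom_value_constraint [] p Hp) S)));
     intros N [HN H] M M' h g Hh Hg; apply (H M M' h); auto;
     intros _; symmetry; eapply sim_low; eauto.
  1: refine (eventually_imp _ _ _ (IHp S)); intros N H M M' h g Hh Hg;
     specialize (H M M' h g Hh Hg); tauto.
  all: apply incl_app_inv in S as [S1 S2];
    refine (eventually_imp _ _ _ (eventually_and _ _ (IHp S1) (IHq S2)));
    intros N [H1 H2] M M' h g Hh Hg;
    specialize (H1 M M' h g Hh Hg); specialize (H2 M M' h g Hh Hg); tauto.
Qed.

(** * The two indistinguishable models *)

Definition array_model (f : Z -> Z) (e : nat -> Z) : model :=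
  fun s => match s return nat -> dom s with
           | Int => e
           | Array Int Int => fun _ => f
           | s => fun _ => zero s
           end.

Definition one_spike (N : Z) : model :=
  array_model (fun z => if z =? N then 1 else 0) (fun _ => N).

(** Integer constants 0 and 1, the local indices of [nonzero_at_two], get the values [N] and
    [N + 1]; in [one_spike] constant 2, the local index of [zero_except_one], gets [N]. *)
Definition two_spikes (N : Z) : model :=
  array_model (fun z => if z =? N then 1 else if z =? N + 1 then 1 else 0)
    (fun c => N + Z.of_nat c).

Ltac case_Z := repeat (simpl;
  match goal with
  | |- context [Z.leb ?x ?y] => destruct (Z.leb_spec x y)
  | |- context [Z.eqb ?x ?y] => destruct (Z.eqb_spec x y)
  end); simpl; try lia.

(** The map collapses [N + 1] onto [N] and shifts later indices down. *)
Lemma one_spike_simulates_two_spikes (N : Z) :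
  simulation N (fun z => if z <=? N then z else z - 1) (one_spike N) (two_spikes N).
Proof. split; unfold vanishes_below, shared_array; simpl; intros; case_Z. Qed.

(** The map skips [N + 1]. *)
Lemma two_spikes_simulates_one_spike (N : Z) :
  simulation N (fun z => if z <=? N then z else z + 1) (two_spikes N) (one_spike N).
Proof. split; unfold vanishes_below, shared_array; simpl; intros; case_Z. Qed.

(** * The interpolation problem and its lack of an interpolant *)

(** A guard may not negate an equality with a quantified variable, so being different from the local
    index is written as two inequalities with offset 1. *)
Definition zero_except_one : formula :=
  forall_vars [0%nat]
    (FImp (FOr (FLe (Var 0) (Sub (Cst Int 2) (Num 1)))
               (FLe (Defs.Add (Cst Int 2) (Num 1)) (Var 0)))
          (FEq (Select array_cst (Var 0)) (Num 0))).

Definition nonzero_at_two : formula :=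
  FAnd (FLt (Cst Int 0) (Cst Int 1))
    (FAnd (FNot (FEq (Select array_cst (Cst Int 0)) (Num 0)))
          (FNot (FEq (Select array_cst (Cst Int 1)) (Num 0)))).

Theorem theorem1 :
  exists A B : formula,
    array_property_fragment A /\
    array_property_fragment B /\
    interpolation_problem A B /\
    ~ (exists I : formula, array_property_fragment I /\ interpolant A B I).
Proof.
  exists zero_except_one, nonzero_at_two; split; [| split; [| split]].
  - apply apf_array_property; constructor.
    + apply guard_or; [apply guard_var_le_term | apply guard_term_le_var];
        simpl; auto.
    + simpl; auto.
  - apply apf_and; [| apply apf_and; apply apf_not];
      apply apf_ground; constructor; simpl; auto.
  - intros M r; simpl; intros [HA (Hlt & H0 & H1)].
    (* Two distinct indices cannot both equal the exceptional one, so the array vanishes at one of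
       them. *)
    destruct (Z.eq_dec (M Int 0%nat) (M Int 2%nat)) as [E | E].
    + apply H1, (HA (M Int 1%nat)); unfold upd; simpl; lia.
    + apply H0, (HA (M Int 0%nat)); unfold upd; simpl; lia.
  - intros (I & HI & AI & IB & Hsyms).
    assert (S : incl (fsyms I) [array_sym]).
    { intros [s c] Hin; destruct (Hsyms s c Hin) as [HA HB].
      simpl in HA, HB |- *; intuition congruence. }
    destruct (array_property_fragment_iff I HI S) as [N H].
    specialize (H N (Z.le_refl N) _ _ _ _ (one_spike_simulates_two_spikes N)
      (two_spikes_simulates_one_spike N)).
    (* [one_spike N] satisfies [zero_except_one], hence [I]; the equivalence moves [I] to
       [two_spikes N], which satisfies [nonzero_at_two]. *)
    apply (IB (two_spikes N) (fun _ => 0)); split.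
    + apply H, AI; simpl; intros z; unfold upd; simpl; case_Z.
    + simpl; case_Z.
Qed.
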